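(* Let $M$ be a (possibly infinite) matroid on ground set $E$ with connectivity function $\lambda$. For every $k\in\mathbb{N}$ there are no infinite $k$-daisies (i.e. no $k$-daisies with infinitely many petals) of the connectivity system $(E,\lambda)$.
   Context: Matroids: a (possibly infinite) matroid on $E$ is given by a set $\mathcal{I}$ of subsets of $E$ (independent sets) such that $\emptyset\in\mathcal{I}$; $\mathcal{I}$ is closed under taking subsets; for every non-maximal $J\in\mathcal{I}$ and maximal $J'\in\mathcal{I}$ there is $x\in J'\setminus J$ with $J\cup\{x\}\in\mathcal{I}$; and whenever $J\subseteq X\subseteq E$ with $J\in\mathcal{I}$, the set $\{J'\in\mathcal{I}:J\subseteq J'\subseteq X\}$ has a maximal element. Bases are maximal independent sets. For $X\subseteq E$ let $M\restriction X$ be the restriction to $X$ and $M.X=M/(E\setminus X)$ the contraction onto $X$. The connectivity of $X$ is $\lambda(X)=|B\setminus B'|\in\mathbb{N}\cup\{\infty\}$, where $B$ is a base of $M\restriction X$ and $B'\subseteq B$ is a base of $M.X$ (the value does not depend on the choices). The function $\lambda$ is symmetric ($\lambda(A)=\lambda(E\setminus A)$), submodular, and limit-closed (unions of chains of sets of connectivity at most $n\in\mathbb{N}$ have connectivity at most $n$), so $(E,\lambda)$ is a connectivity system. The value $\lambda(A)$ is also called the order of $A$. A cyclic order on a set $I$ is a total strict cyclic order; $]x,y[$ is the set of elements strictly between $x$ and $y$ when going from $x$ to $y$. An interval of $I$ is a subset $Y\subseteq I$ such that for all distinct $x,z\in Y$ at least one of $]x,z[$ and $]z,x[$ is contained in $Y$;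 it is non-trivial if $Y\notin\{\emptyset,I\}$. A $k$-pseudoflower is a partition $(P_i)_{i\in I}$ of $E$ (into non-empty classes, called petals) with a cyclically ordered index set $I$ such that the union of any interval of partition classes has order at most $k-1$. A concatenation of a $k$-pseudoflower $(P_i)_{i\in I}$ is a $k$-pseudoflower $(Q_i)_{i\in I'}$ such that for every $i\in I$ there is $f(i)\in I'$ with $P_i\subseteq Q_{f(i)}$, and such that for all intervals $I''$ of $I'$ the set $f^{-1}(I'')$ is an interval of $I$. A $k$-flower is a $k$-pseudoflower with at least four petals in which the union of any non-trivial interval of petals has order exactly $k-1$. A $k$-daisy is a $k$-flower such that every concatenation of it with finitely many petals has the property that the non-trivial unions of petals (unions of a non-empty proper subset of the petals) which have order $k-1$ are exactly those where the indices of the petals form an interval of the index set. *)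

(* Defs.v *)
From mathcomp Require Import all_boot.
From mathcomp Require Import boolp classical_sets functions cardinality.

Set Implicit Arguments.
Unset Strict Implicit.
Unset Printing Implicit Defensive.

Local Open Scope classical_set_scope.

Definition maximal_in (T : Type) (F : set (set T)) (J : set T) : Prop :=
  F J /\ forall K, F K -> J `<=` K -> K = J.

(* The data of a matroid without its axioms, so that restriction, duality and
   contraction can be written down before one knows that they preserve them. *)
Record prematroid (T : Type) := Prematroid {
  ground : set T;
  indep : set (set T) }.

Definition base (T : Type) (M : prematroid T) : set (set T) :=
  maximal_in (indep M).

Record is_matroid (T : Type) (M : prematroid T) : Prop := IsMatroid {
  indep_ground : forall J, indep M J -> J `<=` ground M;
  indep0 : indep M set0;
  indep_sub : forall J K, indep M K -> J `<=` K -> indep M J;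
  indep_exchange : forall J J', indep M J -> ~ base M J -> base M J' ->
    exists2 x, (J' `\` J) x & indep M (J `|` [set x]);
  indep_maximal : forall J X, indep M J -> J `<=` X -> X `<=` ground M ->
    exists K, maximal_in [set J' | [/\ indep M J', J `<=` J' & J' `<=` X]] K }.

Record matroid (T : Type) := Matroid {
  matroid_val :> prematroid T;
  matroidP : is_matroid matroid_val }.

Definition restrict (T : Type) (M : prematroid T) (X : set T) : prematroid T :=
  Prematroid X [set J | indep M J /\ J `<=` X].

Definition dual (T : Type) (M : prematroid T) : prematroid T :=
  Prematroid (ground M)
    [set J | J `<=` ground M /\ exists2 B, base M B & J `&` B = set0].

(* M.X = M / (E \ X), i.e. the dual of the deletion of E \ X from the dual. *)
Definition contract_onto (T : Type) (M : prematroid T) (X : set T) :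
  prematroid T := dual (restrict (dual M) X).

(* Values in nat together with infinity; None stands for infinity. *)
Definition ecard (T : Type) (A : set T) : option nat :=
  if pselect (finite_set A) is left fA then Some (projT1 (cid fA)) else None.

(* The bases are picked by choice: for a matroid M and X included in its ground
   set such a pair (B, B') exists and |B \ B'| is the same for all of them. *)
Definition connectivity (T : Type) (M : prematroid T) (X : set T) :
  option nat :=
  let BB' := xget (set0, set0)
    [set p : set T * set T | [/\ base (restrict M X) p.1, p.2 `<=` p.1
                               & base (contract_onto M X) p.2]] in
  ecard (BB'.1 `\` BB'.2).

(* [cyc x y z]: going from x one meets y strictly before z. Cyclicity and
   asymmetry force x, y, z to be pairwise distinct. *)
Record cyclic_order (I : Type) := CyclicOrder {
  cyc :> I -> I -> I -> Prop;
  cyc_rot : forall x y z, cyc x y z -> cyc y z x;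
  cyc_asym : forall x y z, cyc x y z -> ~ cyc z y x;
  cyc_trans : forall x y z w, cyc x y z -> cyc x z w -> cyc x y w;
  cyc_total : forall x y z, x <> y -> y <> z -> z <> x ->
    cyc x y z \/ cyc z y x }.

Definition between (I : Type) (C : cyclic_order I) (x y : I) : set I :=
  [set z | C x z y].

Definition interval (I : Type) (C : cyclic_order I) (Y : set I) : Prop :=
  forall x z, Y x -> Y z -> x <> z ->
    between C x z `<=` Y \/ between C z x `<=` Y.

Definition nontrivial (I : Type) (Y : set I) : Prop :=
  Y <> set0 /\ Y <> setT.

(* Flowers and daisies of a set E with an order function lam. The order k - 1
   is not truncated: no set has order at most k - 1 when k = 0. *)

Definition order_le_pred (T : Type) (lam : set T -> option nat) (k : nat)
  (X : set T) : Prop := exists2 n, lam X = Some n & n.+1 <= k.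

Definition order_eq_pred (T : Type) (lam : set T -> option nat) (k : nat)
  (X : set T) : Prop := exists2 n, lam X = Some n & n.+1 = k.

Record pseudoflower (T : Type) (E : set T) (lam : set T -> option nat)
    (k : nat) (I : Type) (C : cyclic_order I) (P : I -> set T) : Prop :=
  Pseudoflower {
  petal_nonempty : forall i, P i !=set0;
  petal_disjoint : trivIset setT P;
  petal_cover : \bigcup_i P i = E;
  petal_interval : forall Y, interval C Y ->
    order_le_pred lam k (\bigcup_(i in Y) P i) }.

Definition concatenation (T : Type) (E : set T) (lam : set T -> option nat)
    (k : nat) (I : Type) (C : cyclic_order I) (P : I -> set T)
    (I' : Type) (C' : cyclic_order I') (Q : I' -> set T) : Prop :=
  pseudoflower E lam k C' Q /\
  exists f : I -> I', (forall i, P i `<=` Q (f i)) /\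
    (forall Y, interval C' Y -> interval C (f @^-1` Y)).

Definition flower (T : Type) (E : set T) (lam : set T -> option nat)
    (k : nat) (I : Type) (C : cyclic_order I) (P : I -> set T) : Prop :=
  [/\ pseudoflower E lam k C P,
      (`I_4 #<= [set: I])%card
    & forall Y, interval C Y -> nontrivial Y ->
        order_eq_pred lam k (\bigcup_(i in Y) P i)].

Definition daisy (T : Type) (E : set T) (lam : set T -> option nat)
    (k : nat) (I : Type) (C : cyclic_order I) (P : I -> set T) : Prop :=
  flower E lam k C P /\
  forall (I' : Type) (C' : cyclic_order I') (Q : I' -> set T),
    finite_set [set: I'] -> concatenation E lam k C P C' Q ->
    forall Y : set I', nontrivial Y ->
      (order_eq_pred lam k (\bigcup_(i in Y) Q i) <-> interval C' Y).

(* Main.v *)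
Require Import Defs.
From mathcomp Require Import all_boot.
From mathcomp Require Import boolp classical_sets functions cardinality.
From mathcomp Require Import zify.

Set Implicit Arguments.
Unset Strict Implicit.
Unset Printing Implicit Defensive.

Local Open Scope classical_set_scope.

(** The proof rests on relative independence.  Say that A and B are skew over C
    when sets that are independent in A over C stay independent over C together
    with B.  This relation behaves like conditional independence (weak union,
    contraction, and symmetry for disjoint sets), and the local connectivity
    lconn A B C measures how far A and B are from being skew over C.  Expanding
    connectivities along a partition p, q, r, s of the ground set gives

      lambda(p u q) + lambda(q u r)
        = lambda(q) + lambda(p u q u r) + lconn(p, r | q) + lconn(p, r | s).

    Hence, in a flower, if p, q, r, s are consecutive arcs then all four values
    of lambda agree and p, r are skew over q and over s (skew_of_modular).
    Conversely, if p and q are adjacent arcs, r and s are the other two, and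
    p, r are skew over q and s, then lambda(q u r) has the same value as
    lambda of an arc (modular_of_skew); a daisy forbids this as soon as q u r
    is not an arc.

    An infinite cyclic order maps onto the cyclic order 0 < 1 < 2 < ... < 0 of
    the natural numbers (infinite_cycle_morphism), so the petals may be merged
    into a sequence Q_0, Q_1, ... of arcs.  Put W = Q_3 u Q_4 u ...; the arcs
    are, in cyclic order, Q_0, Q_1, Q_2, W, and Q_0 touches W only in the limit.
    A bounded stretch of W is separated from Q_0 by a whole arc of W, so Q_0 is
    skew to it; the point is that this passes to the union.  Skewness from a
    union can be tested locally (skew_local): if every element of D lies in a
    part D' of D that is skew to the rest of D together with A, then A is skew
    to D.  The petals of odd index have gaps between them, so this test applies
    to their union over Q_1 and over Q_2; once these are in the base, the petals
    of even index pass the test as well.  Thus Q_0 and W are skew over Q_1 and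
    over Q_2 (skew_tail), and modular_of_skew makes lambda(Q_1 u W) the value of
    an arc although Q_1 and W are opposite in the four-petal concatenation
    Q_0, Q_1, Q_2, W. *)

(** * The closure operator of an infinite matroid *)

Ltac set_unfold :=
  cbv [setU setI setD setC set1 set0 setT mkset subset preimage] in *.

Ltac set_tauto := set_unfold; intuition (subst; auto).

Ltac set_eq := apply/seteqP; split; set_tauto.

Section Closure.
Context {T : Type} (M : matroid T).
Implicit Types (A B C D J K L X Y : set T) (x y z : T).

(** Elements outside the ground set are loops, so they lie in every closure. *)
Definition cl X : set T :=
  [set x | X x \/ exists J, [/\ indep M J, J `<=` X & ~ indep M (J `|` [set x])]].

Lemma ind_sub J K : indep M K -> J `<=` K -> indep M J.
Proof. exact: (indep_sub (matroidP M)). Qed.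

Lemma ind_ground J : indep M J -> J `<=` ground M.
Proof. exact: (indep_ground (matroidP M)). Qed.

Lemma base_extend J X : indep M J -> J `<=` X ->
  exists2 B, base (Defs.restrict M X) B & J `<=` B.
Proof.
move=> iJ JX.
have JXE : J `<=` X `&` ground M by move=> t Jt; split; [apply: JX|apply: (ind_ground iJ)].
have [|K [[iK JK KX] maxK]] := indep_maximal (matroidP M) iJ JXE; first by set_tauto.
exists K => //; split; first by split => // t /KX [].
move=> L [iL LX] KL; apply: maxK => //; split => //; first exact: subset_trans KL.
by move=> t Lt; split; [apply: LX|apply: (ind_ground iL)].
Qed.

Lemma baseT B : base (Defs.restrict M setT) B -> base M B.
Proof. by move=> [[iB _] maxB]; split => // K iK; apply: maxB; split. Qed.

Lemma base_maximal X B x : base (Defs.restrict M X) B -> X x -> indep M (B `|` [set x]) -> B x.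
Proof.
move=> [[iB BX] maxB] Xx iBx.
rewrite -(maxB (B `|` [set x])); [by right| |by move=> t; left].
by split => // t [/BX|->].
Qed.

(** Exchange against B: if K were not a base of M, some element of B could be
    added to it, but K is already maximal in J `|` B. *)
Lemma base_setU J B K : base M B -> base (Defs.restrict M (J `|` B)) K -> base M K.
Proof.
move=> bB bK; have [[iK KJB] maxK] := bK; apply: contrapT => nbK.
have [x [Bx nKx] iKx] := indep_exchange (matroidP M) iK nbK bB.
by apply/nKx/(base_maximal bK); [right|].
Qed.

(** The exchange axiom relative to a set X, where B is only maximal inside X.
    Failing it, J extends inside J and a base B1 containing B to a base J1 that
    avoids B outside J.  Replacing an element z of J1 by y gives another base J2,
    and exchanging z out of B1 against J2 adds to B an element of X. *)
Lemma base_exchange X B J y : base (Defs.restrict M X) B -> J `<=` X -> X y -> ~ J y ->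
  indep M (J `|` [set y]) -> exists2 x, (B `\` J) x & indep M (J `|` [set x]).
Proof.
move=> bB JX Xy nJy iJy; have [[iB BX] maxB] := bB.
apply: contrapT => noex.
have no x : B x -> ~ J x -> ~ indep M (J `|` [set x]).
  by move=> Bx nJx iJx; apply: noex; exists x.
have [B1 /baseT bB1 BB1] := base_extend iB (@subsetT _ B).
have iJ : indep M J by apply: ind_sub iJy _; left.
have [J1 bJ1 JJ1] := base_extend iJ (@subsetUl _ J B1).
have [[iJ1 J1s] _] := bJ1; have bJ1M := base_setU bB1 bJ1.
have JB x : J1 x -> B x -> J x.
  move=> J1x Bx; apply: contrapT => nJx; apply: (no x Bx nJx).
  by apply: ind_sub iJ1 _ => t [/JJ1|->].
have B1X x : B1 x -> X x -> B x.
  move=> B1x Xx; apply: (base_maximal bB) => //.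
  by apply: ind_sub bB1.1 _ => t [/BB1|->].
have nJ1y : ~ J1 y.
  move=> J1y; have [//|B1y] := J1s _ J1y.
  exact: (nJy (JB _ J1y (B1X _ B1y Xy))).
have [J2 bJ2 JJ2] := base_extend iJy (@subsetUl _ (J `|` [set y]) J1).
have [[iJ2 J2s] _] := bJ2; have bJ2M := base_setU bJ1M bJ2.
have J2y : J2 y by apply: JJ2; right.
have [z J1z nJ2z] : exists2 z, J1 z & ~ J2 z.
  apply: contrapT => no2; apply: nJ1y.
  rewrite -(bJ1M.2 J2) // => t J1t.
  by apply: contrapT => nJ2t; apply: no2; exists t.
have nJz : ~ J z by move=> Jz; apply: nJ2z; apply: JJ2; left.
have B1z : B1 z by have [] := J1s _ J1z.
have nBz : ~ B z by move=> /(JB _ J1z).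
have iB1z : indep M (B1 `\ z) by apply: ind_sub bB1.1 _ => t [].
have nbB1z : ~ base M (B1 `\ z).
  move=> [_ /(_ B1 bB1.1)] h; have : B1 z by [].
  by rewrite h; [case=> _ /(_ erefl)|move=> t []].
have [w [J2w nw] iw] := indep_exchange (matroidP M) iB1z nbB1z bJ2M.
have nB1w : ~ B1 w.
  move=> B1w; apply: nw; split=> // wz; apply: nJ2z.
  by rewrite -wz.
have Xw : X w.
  case: (J2s _ J2w) => [[/JX //|->//]|/J1s [/JX //|/nB1w //]].
apply: nB1w; apply: (BB1); apply: (base_maximal bB) => //.
apply: ind_sub iw _ => t [Bt|->]; last by right.
by left; split; [apply: BB1|move=> tz; apply: nBz; rewrite -tz].
Qed.

Lemma sub_cl X : X `<=` cl X. Proof. by left. Qed.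

(** The closure may be computed from any single maximal independent subset; by
    base_exchange the choice does not matter. *)
Lemma cl_base X B x : base (Defs.restrict M X) B ->
  cl X x <-> (B x \/ ~ indep M (B `|` [set x])).
Proof.
move=> bB; have [[iB BX] _] := bB; split; last first.
  by case=> [/BX|h]; [left|right; exists B].
move=> clx; apply: contrapT => /not_orP[nBx /contrapT iBx].
have nXx : ~ X x by move=> Xx; apply: nBx; apply: (base_maximal bB).
case: clx => // -[J [iJ JX dJ]].
have [J1 bJ1 JJ1] := base_extend iJ JX; have [[iJ1 J1X] maxJ1] := bJ1.
have bJ1x : base (Defs.restrict M (X `|` [set x])) J1.
  split; first by split => // t /J1X; left.
  move=> K [iK KXx] J1K; apply: maxJ1 => //; split=> // t Kt.
  case: (KXx t Kt) => // tx; case: dJ; apply: ind_sub iK _ => u [/JJ1/J1K //|->].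
  by rewrite -tx.
have [||y [J1y nBy] iBy] := base_exchange bJ1x _ _ nBx iBx; first by move=> t /BX; left.
  by right.
by apply: nBy; apply: (base_maximal bB) => //; apply: J1X.
Qed.

Lemma cl_mono X Y : X `<=` Y -> cl X `<=` cl Y.
Proof.
move=> XY x [/XY|[J [iJ JX dJ]]]; first by left.
by right; exists J; split => //; apply: subset_trans XY.
Qed.

Lemma base_ex X : exists B, base (Defs.restrict M X) B.
Proof.
have [B] := base_extend (indep0 (matroidP M)) (@sub0set _ X).
by exists B.
Qed.

Lemma cl_idem X : cl (cl X) `<=` cl X.
Proof.
have [B bB] := base_ex X; have [[iB BX] maxB] := bB.
have bclB : base (Defs.restrict M (cl X)) B.
  split; first by split => // t /BX; left.
  move=> K [iK KclX] BK; apply/seteqP; split=> // t Kt.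
  have [//|[]] := (cl_base t bB).1 (KclX t Kt).
  by apply: ind_sub iK _ => u [/BK|->].
by move=> x /(cl_base _ bclB) /(cl_base _ bB).
Qed.

Lemma cl_sub X Y : X `<=` cl Y -> cl X `<=` cl Y.
Proof. by move=> XY; apply: subset_trans (@cl_idem Y); apply: cl_mono. Qed.

Lemma base_cl X B : base (Defs.restrict M X) B -> X `<=` cl B.
Proof.
move=> bB x Xx; have [[iB BX] _] := bB.
have clx : cl X x by left.
by have [h|h] := (cl_base x bB).1 clx; [left|right; exists B; split].
Qed.

Lemma cl_exchange X x y : cl (X `|` [set x]) y -> ~ cl X y ->
  cl (X `|` [set y]) x.
Proof.
have [B bB] := base_ex X; have [[iB BX] maxB] := bB.
move=> cly ncly.
have /not_orP[nBy /contrapT iBy] : ~ (B y \/ ~ indep M (B `|` [set y])).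
  by move/(cl_base _ bB).
have nclx : ~ cl X x.
  by move=> clx; apply: ncly; apply: cl_sub cly => t [/sub_cl|->].
have /not_orP[nBx /contrapT iBx] : ~ (B x \/ ~ indep M (B `|` [set x])).
  by move/(cl_base _ bB).
have [B' bB' BB'] : exists2 B', base (Defs.restrict M (X `|` [set x])) B' & B `|` [set x] `<=` B'.
  by apply: base_extend => // t [/BX h|h]; [left|right].
have B'E : B' = B `|` [set x].
  apply/seteqP; split=> // t B't.
  have [[iB' B'X] _] := bB'; have [Xt|] := B'X _ B't; last by right.
  left; apply: (base_maximal bB) => //.
  by apply: ind_sub iB' _ => u [Bu|->//]; apply: BB'; left.
have [|d] := (cl_base y bB').1 cly.
  by rewrite B'E => -[//|->]; left; right.
right; exists (B `|` [set y]); split=> //; first by move=> t [/BX h|h]; [left|right].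
move=> i; apply: d; rewrite B'E; apply: ind_sub i _ => t; set_tauto.
Qed.

Lemma indP J : indep M J <-> forall x, J x -> ~ cl (J `\ x) x.
Proof.
split=> [iJ x Jx [[_ /(_ erefl)//]|[K [_ KJ]]]|h].
  by apply; apply: ind_sub iJ _ => t [/KJ []|->].
have [B bB] := base_ex J; have [[iB BJ] _] := bB.
suff -> : J = B by [].
apply/seteqP; split=> // x Jx; apply: contrapT => nBx; apply: (h x Jx).
apply: cl_mono (base_cl bB Jx) => t Bt; split; first exact: BJ.
by move=> tx; apply: nBx; rewrite -tx.
Qed.

End Closure.

(** * Relative independence and skewness *)

Section Relative.
Context {T : Type} (M : matroid T).
Implicit Types (A B C D J K L X Y : set T) (x y z : T).
Local Notation cl := (cl M).

Definition indep_over C J := forall x, J x -> ~ cl (C `|` (J `\ x)) x.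

Definition base_over C A J :=
  [/\ J `<=` A, indep_over C J & A `<=` cl (C `|` J)].

(** For sets of finite rank, this says that the rank of A over C does not drop
    when B is added to C. *)
Definition skew A B C :=
  forall J, J `<=` A -> indep_over C J -> indep_over (C `|` B) J.

Lemma indep_over_mono C D J K :
  indep_over C J -> D `<=` C -> K `<=` J -> indep_over D K.
Proof.
move=> iJ DC KJ x Kx clx; apply: (iJ x (KJ _ Kx)); apply: cl_mono clx.
by move=> t [/DC h|[/KJ h h']]; [left|right].
Qed.

Lemma indep_over_cl C D J :
  D `<=` cl C -> indep_over C J -> indep_over D J.
Proof.
move=> DC iJ x Jx clx; apply: (iJ x Jx); apply: cl_sub clx => t [/DC|] h.
  by apply: cl_mono h; left.
by apply: sub_cl; right.
Qed.

Lemma indep_over0 J : indep_over set0 J <-> indep M J.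
Proof. by rewrite indP /indep_over; under eq_forall do rewrite set0U. Qed.

(** This is what turns independence over C into independence in M, for which
    the existence of maximal sets is an axiom. *)
Lemma indep_setU C J K :
  base (Defs.restrict M C) K -> indep_over C J -> indep M (K `|` J).
Proof.
move=> bK iJ; have [[iK KC] _] := bK.
have [B bB KB] := base_extend iK (@subsetUl _ K J).
have [[iB BKJ] _] := bB.
apply: (ind_sub iB) => x [/KB //|Jx]; apply: contrapT => nBx.
apply: (iJ x Jx); apply: cl_mono (base_cl bB (or_intror Jx)) => t Bt.
have [/KC h|Jt] := BKJ t Bt; first by left.
by right; split=> // tx; apply: nBx; rewrite -tx.
Qed.

Lemma base_over_extend C A L : L `<=` A -> indep_over C L ->
  exists2 L', base_over C A L' & L `<=` L'.
Proof.
move=> LA iL; have [K bK] := base_ex M C; have [[iK KC] _] := bK.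
have iKL := indep_setU bK iL.
have KLA : K `|` L `<=` K `|` A by move=> t [|/LA] h; [left|right].
have [B bB KLB] := base_extend iKL KLA; have [[iB BKA] _] := bB.
have CK : C `<=` cl K := base_cl bK.
have LK t : L t -> ~ K t.
  move=> Lt Kt; apply: (iL t Lt); apply: sub_cl; left; exact: KC.
exists (B `\` K); last by move=> t Lt; split; [apply: KLB; right|apply: LK].
split; first by move=> t [/BKA []].
- move=> x [Bx nKx] clx; apply: (((indP M B).1 iB) x Bx).
  apply: cl_sub clx => t [/CK h|[[Bt _] tx]]; last by apply: sub_cl.
  apply: cl_mono h => u Ku; split; first by apply: KLB; left.
  by move=> ux; apply: nKx; rewrite -ux.
- move=> x Ax; apply: cl_mono (base_cl bB (or_intror Ax)) => t Bt.
  by have [Kt|nKt] := pselect (K t); [left; apply: KC|right].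
Qed.

Lemma base_over_ex C A : exists J, base_over C A J.
Proof.
have [||J bJ _] := @base_over_extend C A set0; [by []|by move=> x []|by exists J].
Qed.

(** For infinite L this is no finite exchange argument: extend J to a base of
    J `|` L over C; an element of L that it misses would be spanned by the rest. *)
Lemma indep_overU C J L :
  indep_over C J -> indep_over (C `|` J) L -> indep_over C (J `|` L).
Proof.
move=> iJ iL.
have [L' [L'JL iL' sL'] JL'] := base_over_extend (@subsetUl _ J L) iJ.
apply: (indep_over_mono iL') => // x [/JL' //|Lx]; apply: contrapT => nL'x.
apply: (iL x Lx); apply: cl_mono (sL' x (or_intror Lx)) => t [Ct|L't].
  by left; left.
have [Jt|Lt] := L'JL _ L't; first by left; right.
by right; split=> // tx; apply: nL'x; rewrite -tx.
Qed.

Lemma indep_overUr C J L : J `<=` ~` L ->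
  indep_over C (J `|` L) -> indep_over (C `|` J) L.
Proof.
move=> JL iJL x Lx clx; apply: (iJL x); first by right.
apply: cl_mono clx => t [[Ct|Jt]|[Lt tx]]; [by left|right..].
  by split; [left|move=> tx; apply: (JL t Jt); rewrite tx].
by split; [right|].
Qed.

Lemma base_over_cl C A J : base_over C A J -> C `|` A `<=` cl (C `|` J).
Proof. by move=> [_ _ AJ] t [Ct|/AJ //]; apply: sub_cl; left. Qed.

Lemma skew_sub A A' B B' C : skew A B C -> A' `<=` A -> B' `<=` B -> skew A' B' C.
Proof.
move=> s AA BB J JA iJ; apply: (indep_over_mono (s J _ iJ)) => //.
  exact: subset_trans AA.
by move=> t [|/BB] h; [left|right].
Qed.

Lemma skew_weak_union A B D C : skew A (B `|` D) C -> skew A B (C `|` D).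
Proof.
move=> s J JA iJ; apply: indep_over_mono (s J JA _) _ _ => //.
  by apply: indep_over_mono iJ _ _ => // t; left.
by move=> t; set_tauto.
Qed.

Lemma skew_contraction A B D C :
  skew A D C -> skew A B (C `|` D) -> skew A (D `|` B) C.
Proof. by move=> s1 s2 J JA iJ; rewrite setUA; apply: s2 => //; apply: s1. Qed.

(** For a base L of A over C, both L over C `|` J and J over C are independent,
    so J `|` L is; reading this the other way round, J is independent over L. *)
Lemma skew_sym A B C : A `<=` ~` B -> skew A B C -> skew B A C.
Proof.
move=> AB s J JB iJ.
have [L bL] := base_over_ex C A; have [LA iL _] := bL.
have iLB := s L LA iL.
have iLJ : indep_over (C `|` J) L.
  by apply: indep_over_mono iLB _ _ => // t [|/JB]; [left|right].
have iJL := indep_overU iJ iLJ.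
apply: (@indep_over_cl (C `|` L)); first exact: base_over_cl.
apply: indep_overUr; first by move=> t /LA/AB h /JB.
by rewrite setUC.
Qed.

(** Both sides may be shrunk, and anything taken from them may be moved into
    the set over which they are skew. *)
Lemma skew_refine A B C A' B' D : A `<=` ~` B -> skew A B C ->
  A' `<=` A -> B' `<=` B -> D `<=` A `|` B -> skew A' B' (C `|` D).
Proof.
move=> AB s AA BB DAB.
have s1 : skew A B' (C `|` (D `&` B)).
  by apply: skew_weak_union; apply: skew_sub s _ _ => // t [/BB|[]].
have s2 : skew B' A (C `|` (D `&` B)).
  by apply: skew_sym s1 => t /AB h /BB.
have s3 : skew B' A' (C `|` (D `&` B) `|` (D `&` A)).
  by apply: skew_weak_union; apply: skew_sub s2 _ _ => // t [/AA|[]].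
have -> : C `|` D = C `|` (D `&` B) `|` (D `&` A).
  by apply/seteqP; split=> t; have := DAB t; set_tauto.
by apply: skew_sym s3 => t /BB h /AA /AB.
Qed.

(** The limit argument.  Let L be a base of D over C and extend J to a base of
    J `|` L over C.  If it missed an element z of L, then z would depend on J and
    other elements of L; but the part D' around z forbids this. *)
Lemma skew_local A D C : A `<=` ~` D ->
  (forall z, D z -> exists D', [/\ D' z, D' `<=` D & skew D' (A `|` (D `\` D')) C]) ->
  skew A D C.
Proof.
move=> AD loc J JA iJ.
have [L bL] := base_over_ex C D; have [LD iL _] := bL.
have [B [BJL iB sB] JB] := base_over_extend (@subsetUl _ J L) iJ.
have LB : L `<=` B.
  move=> z Lz; apply: contrapT => nBz.
  have [D' [D'z D'D sD']] := loc z (LD z Lz).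
  have iLD : indep_over C (L `&` D') by apply: indep_over_mono iL _ _ => // t [].
  have /(_ z (conj Lz D'z)) := sD' _ (@subIsetr _ L D') iLD.
  apply; apply: cl_mono (sB z (or_intror Lz)) => t [Ct|Bt]; first by left; left.
  have [/JA At|Lt] := BJL t Bt; first by left; right; left.
  have [D't|nD't] := pselect (D' t).
    by right; split=> // tz; apply: nBz; rewrite -tz.
  by left; right; right; split => //; apply: LD.
apply: (@indep_over_cl (C `|` L)); first exact: base_over_cl.
apply: indep_overUr; first by move=> t /LD h /JA /AD.
by apply: indep_over_mono iB _ _ => // t [/LB|/JB].
Qed.

End Relative.

(** * Local connectivity *)

Lemma card_II_unique {T : Type} (A : set T) a b :
  (A #= `I_a -> A #= `I_b -> a = b)%card.
Proof.
move=> Aa Ab; apply/card_eq_II; apply: card_eq_trans Ab.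
by rewrite card_eq_sym.
Qed.

Lemma card_II_add {T : Type} (A B : set T) a b : A `<=` ~` B ->
  (A #= `I_a -> B #= `I_b -> A `|` B #= `I_(a + b))%card.
Proof.
elim: a A => [|a IH] A AB.
  by rewrite II0 card_eq0 => /eqP -> Bb; rewrite set0U.
move=> /eq_cardSP[x Ax Axa] Bb; apply/eq_cardSP; exists x; first by left.
have -> : (A `|` B) `\ x = (A `\ x) `|` B.
  apply/seteqP; split=> t; first by move=> [[At|Bt] tx]; [left|right].
  case=> [[At tx]|Bt]; first by split; [left|].
  by split; [right|move=> tx; apply: (AB x Ax); rewrite -tx].
by apply: IH => // t [/AB].
Qed.

Lemma card_II_split {T : Type} (A B : set T) n : A `<=` ~` B ->
  (A `|` B #= `I_n)%card ->
  exists a b, [/\ n = a + b, (A #= `I_a)%card & (B #= `I_b)%card].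
Proof.
move=> AB ABn; have fAB : finite_set (A `|` B) by exists n.
have [a Aa] : finite_set A by apply: sub_finite_set fAB; left.
have [b Bb] : finite_set B by apply: sub_finite_set fAB; right.
by exists a, b; split => //; apply: card_II_unique ABn (card_II_add AB Aa Bb).
Qed.

Section LocalConnectivity.
Context {T : Type} (M : matroid T).
Implicit Types (A B C D J K L X Y : set T) (x y z : T).
Local Notation cl := (cl M).
Local Notation indep_over := (indep_over M).
Local Notation base_over := (base_over M).
Local Notation skew := (skew M).

(** The exchanges run along the finite difference B2 `\` B1; the rest of the two
    bases may be infinite. *)
Lemma card_base_exchange C B1 B2 n : indep_over C B1 -> indep_over C B2 ->
  B2 `<=` cl (C `|` B1) -> B1 `<=` cl (C `|` B2) ->
  (B2 `\` B1 #= `I_n -> B1 `\` B2 #= `I_n)%card.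
Proof.
elim: n B2 => [|n IH] B2 i1 i2 s2 s1.
  rewrite II0 !card_eq0 => /eqP B20; apply/eqP/seteqP; split => // x [B1x nB2x].
  apply: (i1 x B1x); apply: cl_mono (s1 x B1x) => t [Ct|B2t]; [by left|right].
  split; last by move=> tx; apply: nB2x; rewrite -tx.
  apply: contrapT => nB1t.
  by have : (B2 `\` B1) t by []; rewrite B20.
move=> /eq_cardSP[y [B2y nB1y] cB2].
have [x B1x nclx] : exists2 x, B1 x & ~ cl (C `|` (B2 `\ y)) x.
  apply: contrapT => nex; apply: (i2 y B2y); apply: cl_sub (s2 y B2y) => t [Ct|B1t].
    by apply: sub_cl; left.
  by apply: contrapT => nclt; apply: nex; exists t.
have nB2x : ~ B2 x.
  move=> B2x; apply: nclx; apply: sub_cl; right; split=> // xy.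
  by apply: nB1y; rewrite -xy.
pose B2' := (B2 `\ y) `|` [set x].
have cly : cl (C `|` B2') y.
  rewrite /B2' setUA; apply: cl_exchange => //.
  by apply: cl_mono (s1 x B1x) => t; set_tauto; have [->|h] := pselect (t = y); auto.
have sB2 : C `|` B2 `<=` cl (C `|` B2').
  move=> t [Ct|B2t]; first by apply: sub_cl; left.
  have [->//|ty] := pselect (t = y).
  by apply: sub_cl; right; left.
have i2' : indep_over C B2'.
  apply: indep_overU; first by apply: indep_over_mono i2 _ _ => // t [].
  move=> t -> clx; apply: nclx; apply: cl_mono clx.
  by move=> u [//|[-> /(_ erefl)]].
apply/eq_cardSP; exists x => //.
have -> : (B1 `\` B2) `\ x = B1 `\` B2'.
  rewrite /B2'; apply/seteqP; split => t; set_tauto.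
apply: IH => //.
- move=> t [[B2t _]|->]; first exact: s2.
  by apply: sub_cl; right.
- by move=> t /s1; apply: cl_sub.
- rewrite (_ : B2' `\` B1 = (B2 `\` B1) `\ y) //.
  by rewrite /B2'; apply/seteqP; split => t; set_tauto.
Qed.

(** For finite ranks this is r(A | C) - r(A | C u B); the definition through
    nested bases makes sense whenever the difference is finite. *)
Definition lconn A B C n := exists J J',
  [/\ base_over C A J, J' `<=` J, base_over (C `|` B) J J' & (J `\` J' #= `I_n)%card].

(** J' `|` L and J `|` L' are two bases of J `|` L over C, and their differences
    are the two sets that are compared.  This gives at once the symmetry of lconn
    and its independence of the chosen bases. *)
Lemma lconn_cross A B C J J' L L' n : A `<=` ~` B ->
  base_over C A J -> base_over (C `|` B) J J' ->
  base_over C B L -> base_over (C `|` A) L L' ->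
  (J `\` J' #= `I_n)%card -> (L `\` L' #= `I_n)%card.
Proof.
move=> AB bJ bJ' bL bL' cJ.
have [JA iJ sJ] := bJ; have [J'J iJ' sJ'] := bJ'.
have [LB iL sL] := bL; have [L'L iL' sL'] := bL'.
have dJL t : J t -> L t -> False by move=> /JA /AB h /LB /h.
have sCB : C `|` B `<=` cl (C `|` (J' `|` L)).
  move=> t /(base_over_cl bL); apply: cl_mono; set_tauto.
have sCA : C `|` A `<=` cl (C `|` (J `|` L')).
  move=> t /(base_over_cl bJ); apply: cl_mono; set_tauto.
have e1 : (J `|` L') `\` (J' `|` L) = J `\` J'.
  by apply/seteqP; split=> t; have := dJL t; have := J'J t; have := L'L t; set_tauto.
have e2 : (J' `|` L) `\` (J `|` L') = L `\` L'.
  by apply/seteqP; split=> t; have := dJL t; have := J'J t; have := L'L t; set_tauto.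
rewrite -e2; apply: (@card_base_exchange C); last by rewrite e1.
- rewrite setUC; apply: indep_overU => //; apply: indep_over_mono iJ' _ _ => //.
  by move=> t [|/LB]; [left|right].
- apply: indep_overU => //; apply: indep_over_mono iL' _ _ => //.
  by move=> t [|/JA]; [left|right].
- move=> t [/sJ'|/L'L Lt]; last by apply: sub_cl; right; right.
  by apply: cl_sub => u [/sCB //|J'u]; apply: sub_cl; right; left.
- move=> t [/J'J Jt|/sL']; first by apply: sub_cl; right; left.
  by apply: cl_sub => u [/sCA //|L'u]; apply: sub_cl; right; right.
Qed.

Lemma subsetC_sym A B : A `<=` ~` B -> B `<=` ~` A.
Proof. by move=> AB t Bt At; apply: (AB t). Qed.

Lemma lconn_sym A B C n : A `<=` ~` B -> lconn A B C n -> lconn B A C n.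
Proof.
move=> AB [J [J' [bJ J'J bJ' c]]].
have [L bL] := base_over_ex M C B; have [L' bL'] := base_over_ex M (C `|` A) L.
exists L, L'; split=> //; first by case: bL'.
exact: lconn_cross bJ bJ' bL bL' c.
Qed.

Lemma lconn_card A B C J J' n : A `<=` ~` B -> lconn A B C n ->
  base_over C A J -> base_over (C `|` B) J J' -> (J `\` J' #= `I_n)%card.
Proof.
move=> AB /(lconn_sym AB)[L [L' [bL _ bL' c]]] bJ bJ'.
exact: lconn_cross (subsetC_sym AB) bL bL' bJ bJ' c.
Qed.

Lemma lconn_unique A B C n m : A `<=` ~` B ->
  lconn A B C n -> lconn A B C m -> n = m.
Proof.
move=> AB ln [J [J' [bJ _ bJ' c]]].
exact: card_II_unique (lconn_card AB ln bJ bJ') c.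
Qed.

Lemma base_over_trans C D A J J' : base_over C A J -> base_over D J J' ->
  C `<=` D -> base_over D A J'.
Proof.
move=> [JA iJ sJ] [J'J iJ' sJ'] CD; split=> //; first exact: subset_trans JA.
move=> t /sJ; apply: cl_sub => u [/CD Du|/sJ' //].
by apply: sub_cl; left.
Qed.

(** The chain rule is an equivalence, so that finiteness of the total and of the
    parts need not be discussed separately. *)
Lemma lconn_chain A B D C n : A `<=` ~` B ->
  lconn A (D `|` B) C n <->
  exists n1 n2, [/\ n = n1 + n2, lconn A D C n1 & lconn A B (C `|` D) n2].
Proof.
have spl J J' J'' : J'' `<=` J' -> J' `<=` J ->
    J `\` J'' = (J `\` J') `|` (J' `\` J'') /\ J `\` J' `<=` ~` (J' `\` J'').
  move=> s1 s2; split; last by move=> t [_ h] [].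
  apply/seteqP; split=> t; have := s1 t; have := s2 t; set_tauto.
  by have [] := pselect (J' t); auto.
move=> AB; split.
- move=> [J [J'' [bJ J''J bJ'' c]]]; have [_ iJ'' sJ''] := bJ''.
  have iJ2 : indep_over (C `|` D) J''.
    by apply: indep_over_mono iJ'' _ _ => //; rewrite setUA; left.
  have [J' bJ' J''J'] := base_over_extend J''J iJ2; have [J'J iJ' sJ'] := bJ'.
  have [e d] := spl _ _ _ J''J' J'J.
  have [n1 [n2 [-> c1 c2]]] := card_II_split d (eq_rect _ (fun X => X #= `I_n)%card c _ e).
  exists n1, n2; split => //; first by exists J, J'.
  exists J', J''; split=> //; first by apply: base_over_trans bJ bJ' _; left.
  by rewrite -setUA; split=> // t /J'J /sJ''.
- move=> [n1 [n2 [-> [J [J' [bJ J'J bJ' c1]]] l2]]].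
  have [J'' bJ''] := base_over_ex M (C `|` D `|` B) J'.
  have bJA : base_over (C `|` D) A J' by apply: base_over_trans bJ bJ' _; left.
  have c2 := lconn_card AB l2 bJA bJ''.
  have J''J' : J'' `<=` J' by case: bJ''.
  have [e d] := spl _ _ _ J''J' J'J.
  exists J, J''; split=> //; first exact: subset_trans J'J.
    by rewrite setUA; apply: base_over_trans bJ' bJ'' _; left.
  by rewrite e; apply: card_II_add.
Qed.

Lemma skew_lconn A B C : A `<=` ~` B -> skew A B C <-> lconn A B C 0.
Proof.
move=> AB; split=> [s|l].
  have [J bJ] := base_over_ex M C A; have [JA iJ sJ] := bJ.
  exists J, J; rewrite setDv II0; split=> //.
  by split=> //; [apply: s|move=> t Jt; apply: sub_cl; right].
move=> J JA iJ; have [K bK JK] := base_over_extend JA iJ; have [KA iK _] := bK.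
have [K' bK'] := base_over_ex M (C `|` B) K; have [K'K iK' _] := bK'.
have := lconn_card AB l bK bK'; rewrite II0 card_eq0 => /eqP K0.
apply: indep_over_mono iK' _ _ => // t /JK Kt; apply: contrapT => nK't.
by have : (K `\` K') t by []; rewrite K0.
Qed.

(** A base of M.X is the trace on X of a base of M that meets X in a minimal
    set, which means that it contains a base of the complement of X.  So the
    contraction is described by independence over that complement. *)
Lemma contract_onto_base X J : X `<=` ground M ->
  base (contract_onto M X) J <-> base_over (ground M `\` X) X J.
Proof.
move=> XE.
have dualP L B : base M B -> L `<=` X -> L `&` B = set0 ->
    indep (Defs.restrict (dual M) X) L.
  by move=> bB LX LB; split=> //; split; [apply: subset_trans XE|exists B].
have base_ground B : base M B -> ground M `<=` cl B.
  move=> bB; apply: base_cl; split; last by move=> K [iK _]; apply: bB.2.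
  by split; [exact: bB.1|apply: ind_ground; exact: bB.1].
have coindep_minimal L : base (Defs.restrict (dual M) X) L ->
    base_over (ground M `\` X) X (X `\` L).
  move=> [[[LE [B0 bB0 LB0]] LX] maxL].
  have XLE : X `\` L = X `&` B0.
    rewrite -(maxL (X `\` B0)).
    - by apply/seteqP; split=> t; set_tauto; apply: contrapT; auto.
    - by apply: dualP bB0 _ _; [move=> t []|apply/seteqP; split=> t // [[_ h] /h]].
    - move=> t Lt; split; first exact: LX.
      by move=> B0t; have : (L `&` B0) t by []; rewrite LB0.
  have iB0X : indep M (B0 `\` X) by apply: ind_sub bB0.1 _ => t [].
  have B0XE : B0 `\` X `<=` ground M `\` X.
    by move=> t [B0t nXt]; split=> //; apply: (ind_ground bB0.1).
  have [K bK B0XK] := base_extend iB0X B0XE; have [[iK KE] _] := bK.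
  have [B1 bB1 KB1] := base_extend iK (@subsetUl _ K B0).
  have [[iB1 B1KB] _] := bB1; have bB1M := base_setU bB0 bB1.
  have B1X t : X t -> B1 t -> B0 t.
    by move=> Xt /B1KB [/KE []|].
  have LXB1 : X `\` B1 = L.
    apply: maxL.
      by apply: dualP bB1M _ _; [move=> t []|apply/seteqP; split=> t // [[_ h] /h]].
    move=> t Lt; split; first exact: LX.
    move=> B1t; have : (X `\` L) t by rewrite XLE; split; [apply: LX|apply: B1X => //; apply: LX].
    by case.
  have XLB1 : X `\` L = X `&` B1.
    by rewrite -LXB1; apply/seteqP; split=> t; set_tauto; apply: contrapT; auto.
  have B1E t : B1 t -> X t \/ K t.
    move=> /[dup] B1t /B1KB [|B0t]; first by right.
    by have [Xt|nXt] := pselect (X t); [left|right; apply: B0XK].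
  split; first by move=> t [].
  - move=> x XLx; have XB1x := XLx; rewrite XLB1 in XB1x; have [Xx B1x] := XB1x.
    move=> clx; apply: ((indP M B1).1 iB1 x B1x); apply: cl_sub clx => t.
    case=> [Et|[]].
      apply: cl_mono (base_cl bK Et) => u Ku; split; first exact: KB1.
      by move=> ux; have [_] := KE u Ku; rewrite ux.
    by rewrite XLB1 => -[Xt B1t] tx; apply: sub_cl.
  - move=> x /XE /(base_ground _ bB1M); apply: cl_mono => t B1t.
    have [Xt|Kt] := B1E t B1t; last by left; apply: KE.
    by right; rewrite XLB1.
split.
- move=> [[JX [L bL JL]] maxJ].
  suff -> : J = X `\` L by exact: coindep_minimal.
  apply/esym/maxJ.
    by split; [move=> t []|exists L => //; apply/seteqP; split=> t // [[_ h] /h]].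
  move=> t Jt; split; first exact: JX.
  by move=> Lt; have : (J `&` L) t by []; rewrite JL.
- move=> bJ; have [JX iJ sJ] := bJ.
  have [K bK] := base_ex M (ground M `\` X); have [[iK KE] _] := bK.
  have iKJ := indep_setU bK iJ.
  have bKJ : base M (K `|` J).
    have sKJ : ground M `<=` cl (K `|` J).
      move=> t Et; have [/sJ|nXt] := pselect (X t); last first.
        by apply: cl_mono (base_cl bK (conj Et nXt)) => u; left.
      apply: cl_sub => u [/(base_cl bK)|Ju]; last by apply: sub_cl; right.
      by apply: cl_mono => v; left.
    split=> // B iB KJB; apply/seteqP; split=> // x Bx; apply: contrapT => nKJx.
    apply: ((indP M B).1 iB x Bx); apply: cl_mono (sKJ x (ind_ground iB Bx)) => t KJt.
    by split; [apply: KJB|move=> tx; apply: nKJx; rewrite -tx].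
  have bL : base (Defs.restrict (dual M) X) (X `\` J).
    split.
      apply: dualP bKJ _ _; first by move=> t [].
      by apply/seteqP; split=> t // [[Xt nJt] [/KE []|]].
    move=> L [[LE [B1 bB1 LB1]] LX] JL; apply/seteqP; split=> // z Lz.
    split; [exact: LX|move=> Jz].
    apply: (iJ z Jz); apply: cl_mono (base_ground _ bB1 z (LE _ Lz)) => t B1t.
    have [Xt|nXt] := pselect (X t); last by left; split=> //; apply: (ind_ground bB1.1).
    have nLt : ~ L t by move=> Lt; have : (L `&` B1) t by []; rewrite LB1.
    right; split; last by move=> tz; apply: nLt; rewrite tz.
    by apply: contrapT => nJt; apply: nLt; apply: JL.
  split.
    by split=> //; exists (X `\` J) => //; apply/seteqP; split=> t // [h [_ /(_ h)]].
  move=> J2 [J2X [L bL2 J2L]] JJ2; have [_ i2 _] := coindep_minimal L bL2.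
  have J2XL : J2 `<=` X `\` L.
    move=> t J2t; split; first exact: J2X.
    by move=> Lt; have : (J2 `&` L) t by []; rewrite J2L.
  apply/seteqP; split=> // z J2z; apply: contrapT => nJz.
  apply: (i2 z (J2XL z J2z)); apply: cl_mono (sJ z (J2X z J2z)) => t [|Jt]; first by left.
  right; split; first by apply/J2XL/JJ2.
  by move=> tz; apply: nJz; rewrite -tz.
Qed.

Lemma restrict_base X J : base (Defs.restrict M X) J <-> base_over set0 X J.
Proof.
split=> [bJ|[JX /indep_over0 iJ sJ]].
  have [[iJ JX] _] := bJ; split=> //; first exact/indep_over0.
  by rewrite set0U; apply: base_cl.
split=> // K [iK KX] JK; apply/seteqP; split=> // x Kx; apply: contrapT => nJx.
apply: ((indP M K).1 iK x Kx); apply: cl_mono (sJ x (KX x Kx)) => t [//|Jt].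
by split; [apply: JK|move=> tx; apply: nJx; rewrite -tx].
Qed.

Lemma ecardP (A : set T) n : ecard A = Some n <-> (A #= `I_n)%card.
Proof.
rewrite /ecard; case: pselect => [fA|nfA]; last first.
  by split=> // An; case: nfA; exists n.
case: cid => m Am /=; split=> [[<-] //|An].
by congr Some; apply: card_II_unique Am An.
Qed.

(** The connectivity of X is the local connectivity of X with its complement. *)
Lemma connectivityP X n : X `<=` ground M ->
  connectivity M X = Some n <-> lconn X (ground M `\` X) set0 n.
Proof.
move=> XE; rewrite /connectivity.
set F := [set p | _]; set p := xget _ F.
have [bp1 p21 bp2] : F p.
  apply: xgetPex; have [J bJ] := base_over_ex M set0 X.
  have [J' bJ'] := base_over_ex M (set0 `|` (ground M `\` X)) J.
  exists (J, J'); split => /=; [exact/restrict_base|by case: bJ'|].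
  by apply/contract_onto_base => //; have := base_over_trans bJ bJ'; rewrite set0U; apply.
move/restrict_base: bp1 => bp1; have [p1X _ _] := bp1.
move/(contract_onto_base _ XE): bp2 => -[p2X ip2 sp2].
have bp : base_over (set0 `|` (ground M `\` X)) p.1 p.2.
  by rewrite set0U; split => // t /p1X /sp2.
rewrite ecardP; split=> [c|l]; first by exists p.1, p.2.
by apply: lconn_card l bp1 bp => t Xt [].
Qed.

End LocalConnectivity.

(** * Modular pairs of sets and skewness *)

Section Modularity.
Context {T : Type} (M : matroid T).
Implicit Types (A B C D X Y : set T) (p q r s : set T).
Local Notation lconn := (lconn M).
Local Notation skew := (skew M).

Lemma lconn_chainl A B D C n : D `|` A `<=` ~` B ->
  lconn (D `|` A) B C n <->
  exists n1 n2, [/\ n = n1 + n2, lconn D B C n1 & lconn A B (C `|` D) n2].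
Proof.
move=> DAB.
have DB : D `<=` ~` B by move=> t Dt; apply: DAB; left.
have AB : A `<=` ~` B by move=> t At; apply: DAB; right.
split.
  move=> /(lconn_sym DAB)/(lconn_chain _ _ _ _ (subsetC_sym AB))[n1 [n2 [-> l1 l2]]].
  by exists n1, n2; split=> //; apply: lconn_sym => //; apply: subsetC_sym.
move=> [n1 [n2 [nE l1 l2]]]; apply: lconn_sym; first exact: subsetC_sym.
apply/(lconn_chain _ _ _ _ (subsetC_sym AB)).
by exists n1, n2; split=> //; apply: lconn_sym.
Qed.

Lemma connectivity_lconn X Y n : X `<=` ~` Y -> X `|` Y = ground M ->
  connectivity M X = Some n <-> lconn X Y set0 n.
Proof.
move=> XY E; have XE : X `<=` ground M by rewrite -E; left.
rewrite (connectivityP _ XE) (_ : _ `\` _ = Y) //.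
by rewrite -E; apply/seteqP; split=> t; have := XY t; set_tauto.
Qed.

Record quadripartition p q r s : Prop := Quadripartition {
  quad_cover : p `|` q `|` r `|` s = ground M;
  quad_pq : p `<=` ~` q; quad_pr : p `<=` ~` r; quad_ps : p `<=` ~` s;
  quad_qr : q `<=` ~` r; quad_qs : q `<=` ~` s; quad_rs : r `<=` ~` s }.

(** The terms in these four expansions match in pairs except for lconn p r q
    and lconn r p s, which are the defect of modularity of p `|` q and q `|` r. *)
Lemma connectivity_split p q r s : quadripartition p q r s ->
  [/\ forall a, connectivity M (p `|` q) = Some a <->
        exists a1 a2 a3, [/\ a = a1 + (a2 + a3), lconn q (r `|` s) set0 a1,
          lconn p r q a2 & lconn p s (r `|` q) a3],
      forall b, connectivity M (q `|` r) = Some b <->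
        exists b1 b2 b3, [/\ b = b1 + (b2 + b3), lconn (r `|` q) s set0 b1,
          lconn r p s b2 & lconn q p (r `|` s) b3],
      forall c, connectivity M q = Some c <->
        exists c1 c2, [/\ c = c1 + c2, lconn q (r `|` s) set0 c1 &
          lconn q p (r `|` s) c2] &
      forall d, connectivity M (p `|` q `|` r) = Some d <->
        exists d1 d2, [/\ d = d1 + d2, lconn (r `|` q) s set0 d1 &
          lconn p s (r `|` q) d2]].
Proof.
move=> [E pq pr ps qr qs rs].
have disj t : ((p t -> ~ q t) /\ (p t -> ~ r t) /\ (p t -> ~ s t)) /\
  ((q t -> ~ r t) /\ (q t -> ~ s t) /\ (r t -> ~ s t)).
  exact: (conj (conj (pq t) (conj (pr t) (ps t))) (conj (qr t) (conj (qs t) (rs t)))).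
split.
- move=> a; rewrite (@connectivity_lconn _ (r `|` s)); first last.
  + by rewrite -E; apply/seteqP; split=> t; set_tauto.
  + by move=> t; have := disj t; set_tauto.
  rewrite setUC lconn_chainl; last by move=> t; have := disj t; set_tauto.
  rewrite set0U; split.
  + move=> [a1 [a2 [-> l1 /(lconn_chain _ _ _ _ ps)[a3 [a4 [-> l3 l4]]]]]].
    by exists a1, a3, a4; rewrite (setUC r q).
  + move=> [a1 [a2 [a3 [-> l1 l2 l3]]]]; exists a1, (a2 + a3); split=> //.
    by apply/(lconn_chain _ _ _ _ ps); exists a2, a3; rewrite setUC in l3.
- move=> b; rewrite (@connectivity_lconn _ (s `|` p)); first last.
  + by rewrite -E; apply/seteqP; split=> t; set_tauto.
  + by move=> t; have := disj t; set_tauto.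
  have qrp : r `|` q `<=` ~` p by move=> t; have := disj t; set_tauto.
  rewrite setUC lconn_chain // set0U; split.
  + move=> [b1 [b2 [-> l1 /(lconn_chainl _ _ qrp)[b3 [b4 [-> l3 l4]]]]]].
    by exists b1, b3, b4; rewrite (setUC r s).
  + move=> [b1 [b2 [b3 [-> l1 l2 l3]]]]; exists b1, (b2 + b3); split=> //.
    by apply/(lconn_chainl _ _ qrp); exists b2, b3; rewrite setUC in l3.
- move=> c; rewrite (@connectivity_lconn _ ((r `|` s) `|` p)); first last.
  + by rewrite -E; apply/seteqP; split=> t; set_tauto.
  + by move=> t; have := disj t; set_tauto.
  by rewrite lconn_chain ?set0U //; apply: subsetC_sym.
- move=> d; rewrite (@connectivity_lconn _ s); first last.
  + by rewrite -E; apply/seteqP; split=> t; set_tauto.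
  + by move=> t; have := disj t; set_tauto.
  rewrite -setUA setUC (setUC q) lconn_chainl ?set0U //.
  by move=> t; have := disj t; set_tauto.
Qed.

Lemma skew_of_modular p q r s a b c d : quadripartition p q r s ->
  connectivity M (p `|` q) = Some a -> connectivity M (q `|` r) = Some b ->
  connectivity M q = Some c -> connectivity M (p `|` q `|` r) = Some d ->
  a + b = c + d -> skew p r q /\ skew p r s.
Proof.
move=> Q; have [spq sqr sq spqr] := connectivity_split Q.
case: Q => _ pq pr ps qr qs rs.
move=> /spq[a1 [a2 [a3 [-> la1 la2 la3]]]] /sqr[b1 [b2 [b3 [-> lb1 lb2 lb3]]]].
move=> /sq[c1 [c2 [-> lc1 lc2]]] /spqr[d1 [d2 [-> ld1 ld2]]].
have qrs : q `<=` ~` (r `|` s) by move=> t qt [rt|st]; [apply: (qr t)|apply: (qs t)].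
have rqs : r `|` q `<=` ~` s by move=> t [rt|qt] st; [apply: (rs t)|apply: (qs t)].
rewrite (lconn_unique qrs la1 lc1) (lconn_unique rqs lb1 ld1).
rewrite (lconn_unique ps la3 ld2) (lconn_unique (subsetC_sym pq) lb3 lc2) => e.
have [a20 b20] : a2 = 0 /\ b2 = 0 by lia.
rewrite a20 in la2; rewrite b20 in lb2.
split; apply/skew_lconn => //.
by apply: lconn_sym => //; apply: subsetC_sym.
Qed.

Lemma modular_of_skew p q r s a c d : quadripartition p q r s ->
  connectivity M (p `|` q) = Some a -> connectivity M q = Some c ->
  connectivity M (p `|` q `|` r) = Some d ->
  skew p r q -> skew p r s ->
  exists2 b, connectivity M (q `|` r) = Some b & a + b = c + d.
Proof.
move=> Q; have [spq sqr sq spqr] := connectivity_split Q.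
case: Q => _ pq pr ps qr qs rs.
move=> /spq[a1 [a2 [a3 [-> la1 la2 la3]]]].
move=> /sq[c1 [c2 [-> lc1 lc2]]] /spqr[d1 [d2 [-> ld1 ld2]]].
move=> /(skew_lconn _ _ pr) sk1 /(skew_lconn _ _ pr) sk2.
have qrs : q `<=` ~` (r `|` s) by move=> t qt [rt|st]; [apply: (qr t)|apply: (qs t)].
rewrite (lconn_unique qrs la1 lc1) (lconn_unique ps la3 ld2) (lconn_unique pr la2 sk1).
exists (d1 + c2); last by lia.
by apply/sqr; exists d1, 0, c2; split=> //; apply: lconn_sym.
Qed.

End Modularity.

(** * Cyclic orders and their monotone maps *)

Section CyclicOrders.
Context {I : Type}.
Implicit Types (C : cyclic_order I) (x y z u v : I).

Lemma cyc_rot2 C x y z : C x y z -> C z x y.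
Proof. by move=> h; do 2 apply: cyc_rot. Qed.

Lemma cyc_neq C x y z : C x y z -> [/\ x <> y, y <> z & x <> z].
Proof.
have irr u v : ~ C u u v.
  by move=> h; apply: (cyc_asym h); apply: cyc_rot2.
split=> e; first by apply: (irr x z); rewrite {2}e.
  by apply: (irr y x); rewrite {2}e; apply: cyc_rot.
by apply: (irr z y); rewrite -{2}e; apply: cyc_rot2.
Qed.

Definition rev_cyclic_order C : cyclic_order I.
Proof.
exists (fun x y z => C z y x).
- by move=> x y z h; apply: cyc_rot2.
- by move=> x y z h; apply: cyc_asym.
- move=> x y z w h1 h2; apply: cyc_rot.
  exact: cyc_trans (cyc_rot2 h2) (cyc_rot2 h1).
- by move=> x y z xy yz zx; have [h|h] := cyc_total C xy yz zx; [right|left].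
Defined.

Lemma interval_rev C (Y : set I) : interval (rev_cyclic_order C) Y -> interval C Y.
Proof.
move=> iY x z Yx Yz xz; have [h|h] := iY z x Yz Yx (not_eq_sym xz).
  by left=> t Ct; apply: h.
by right=> t Ct; apply: h.
Qed.

Lemma interval_setC C (Y : set I) : interval C Y -> interval C (~` Y).
Proof.
move=> iY x z nYx nYz xz.
apply: contrapT => /not_orP[/existsNP[u /not_implyP[xuz /contrapT Yu]]
                            /existsNP[v /not_implyP[zvx /contrapT Yv]]].
have zvu : C z v u by apply: cyc_trans zvx _; apply: cyc_rot2.
have xuv : C x u v by apply: cyc_trans xuz _; apply: cyc_rot2.
have [_ uv _] := cyc_neq xuv.
have uzv : C u z v by apply: cyc_rot2.
have vxu : C v x u by apply: cyc_rot2.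
by case: (iY u v Yu Yv uv) => [/(_ z uzv)|/(_ x vxu)].
Qed.

(** The linear order obtained by cutting the cyclic order just before o. *)
Definition cut C o x y := (x = o /\ y <> o) \/ C o x y.

Lemma cut_irr C o x : ~ cut C o x x.
Proof. by move=> [[-> /(_ erefl)//]|/cyc_neq[_ /(_ erefl)]]. Qed.

Lemma cut_trans C o x y z : cut C o x y -> cut C o y z -> cut C o x z.
Proof.
move=> [[-> yo]|oxy] [[yo' zo]|oyz]; [by []| | |].
- by left; split=> // zo; have [_ _] := cyc_neq oyz; rewrite zo => /(_ erefl).
- by have [_ _] := cyc_neq oxy; rewrite yo' => /(_ erefl).
- by right; apply: cyc_trans oxy oyz.
Qed.

Lemma cut_total C o x y : x <> y -> cut C o x y \/ cut C o y x.
Proof.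
move=> xy; have [xo|xo] := pselect (x = o).
  by left; left; split=> // yo; apply: xy; rewrite xo yo.
have [yo|yo] := pselect (y = o); first by right; left.
have [h|h] := cyc_total C (not_eq_sym xo) xy yo; [by left; right|right; right].
exact: cyc_rot2.
Qed.

Lemma cyc_trans_inner C o x y z : C o x y -> C o y z -> C x y z.
Proof.
move=> oxy oyz; apply: cyc_rot2.
exact: cyc_trans (cyc_rot oyz) (cyc_rot2 oxy).
Qed.

Lemma cut_cyc C o x y z : cut C o x y -> cut C o y z -> C x y z.
Proof.
move=> [[-> yo] [[//]|//]|oxy [[yo]|oyz]].
  by have [_ _] := cyc_neq oxy; rewrite yo => /(_ erefl).
exact: cyc_trans_inner oxy oyz.
Qed.

Definition cyclically (R : I -> I -> Prop) x y z :=
  (R x y /\ R y z) \/ (R y z /\ R z x) \/ (R z x /\ R x y).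

Lemma cyclically_cut C o x y z : C x y z -> cyclically (cut C o) x y z.
Proof.
move=> xyz; have [xy yz xz] := cyc_neq xyz; have nzyx := cyc_asym xyz.
rewrite /cyclically.
have [h1|h1] := cut_total C o xy; have [h2|h2] := cut_total C o yz;
  have [h3|h3] := cut_total C o xz; auto.
- by case: nzyx; apply: cyc_rot; apply: cut_cyc h3 h2.
- by case: nzyx; apply: cyc_rot2; apply: cut_cyc h1 h3.
- by case: nzyx; apply: cut_cyc h2 h1.
- by case: nzyx; apply: cut_cyc h2 h1.
Qed.

Lemma dependent_choice (P : set I) (R : I -> I -> Prop) x0 : P x0 ->
  (forall x, P x -> exists2 y, P y & R x y) ->
  exists s : nat -> I, forall n, R (s n) (s n.+1).
Proof.
move=> Px0 step.
have /choice[f fP] : forall u : sig P, exists v : sig P, R (sval u) (sval v).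
  move=> [x Px]; have [y Py Rxy] := step x Px; by exists (exist _ y Py).
exists (fun n => sval (iter n f (exist _ x0 Px0))) => n.
exact: fP.
Qed.

(** If every non-empty set has an R-minimal element, repeatedly take the least
    element above the current one, which exists as long as only finitely many
    elements are not above it.  Otherwise descend in a set without a minimum. *)
Lemma monotone_sequence (R : I -> I -> Prop) :
  (forall x, ~ R x x) -> (forall x y, x <> y -> R x y \/ R y x) ->
  infinite_set [set: I] ->
  exists s : nat -> I,
    (forall n, R (s n) (s n.+1)) \/ (forall n, R (s n.+1) (s n)).
Proof.
move=> irr tot infI.
have [wf|] := pselect (forall Y : set I, Y !=set0 ->
    exists2 m, Y m & forall y, Y y -> ~ R y m); last first.
  move=> /existsNP[Y /not_implyP[[y0 Yy0] nomin]].
  have [|s sP] := @dependent_choice Y (fun x y => R y x) y0 Yy0.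
    move=> x Yx; apply: contrapT => nex; apply: nomin; exists x => // y Yy Ryx.
    by apply: nex; exists y.
  by exists s; right.
pose P : set I := [set x | finite_set [set y | ~ R x y]].
have next Y : finite_set Y -> exists2 m, ~ Y m & forall y, ~ Y y -> ~ R y m.
  move=> fY; apply: (wf (~` Y)); apply: contrapT => nex.
  apply: infI; apply: sub_finite_set fY => t _; apply: contrapT => nYt.
  by apply: nex; exists t.
have [o _ omin] := next set0 (finite_set0 _).
have Po : P o.
  apply: sub_finite_set (finite_set1 o) => y /= noy; apply: contrapT => yo.
  by have [//|/(omin _ (fun f : False => f))] := tot _ _ (not_eq_sym yo).
have [|s sP] := @dependent_choice P R o Po; last by exists s; left.
move=> x Px; have [m /contrapT Rxm mmin] := next _ Px; exists m => //.
apply: (@sub_finite_set _ _ ([set y | ~ R x y] `|` [set m])); last first.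
  by rewrite finite_setU; split=> //; apply: finite_set1.
move=> y /= nmy; have [->|ym] := pselect (y = m); first by right.
left=> Rxy; have [//|Rym] := tot _ _ (not_eq_sym ym).
exact: (mmin y (fun h => h Rxy)).
Qed.

End CyclicOrders.

(** The cyclic order in which the natural numbers are passed upwards and 0
    follows after all of them. *)
Definition nat_cycle : cyclic_order nat.
Proof.
exists (fun x y z => [|| x < y < z, y < z < x | z < x < y]).
- move=> x y z; lia.
- move=> x y z; lia.
- move=> x y z w; lia.
- move=> x y z; lia.
Defined.

Lemma nat_cycleE x y z : nat_cycle x y z = [|| x < y < z, y < z < x | z < x < y] :> Prop.
Proof. by []. Qed.

Definition cycle_morphism (I J : Type) (C : cyclic_order I) (C' : cyclic_order J)
  (f : I -> J) := forall x y z, C x y z ->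
    f x <> f y -> f y <> f z -> f x <> f z -> C' (f x) (f y) (f z).

(** The blocks are the intervals between consecutive terms of s.  The elements
    above the whole sequence go to block 0: in the cyclic order they lie between
    all other blocks and the initial elements. *)
Lemma exists_block_index (I : Type) (R : I -> I -> Prop) (s : nat -> I) :
  (forall x, ~ R x x) -> (forall x y z, R x y -> R y z -> R x z) ->
  (forall n, R (s n) (s n.+1)) ->
  exists2 f : I -> nat, (forall n, f (s n) = n) &
    forall x y z, cyclically R x y z ->
    f x <> f y -> f y <> f z -> f x <> f z -> nat_cycle (f x) (f y) (f z).
Proof.
move=> irr tr sinc.
have slt m n : m < n -> R (s m) (s n).
  elim: n => // n IH; rewrite ltnS leq_eqVlt => /orP[/eqP -> //|/IH h].
  exact: tr h (sinc n).
pose above x := forall n, R (s n) x.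
have /choice[f fP] : forall x, exists n, (above x /\ n = 0) \/
    (~ R (s n) x /\ forall m, m < n -> R (s m) x).
  move=> x; have [ax|/existsNP nax] := pselect (above x); first by exists 0; left.
  have exb : exists n, `[< ~ R (s n) x >] by have [n h] := nax; exists n; apply/asboolP.
  case: (ex_minnP exb) => n /asboolP nR minn; exists n; right; split=> // m mn.
  apply: contrapT => nRm; have := minn m; rewrite leqNgt mn.
  by move=> h; have := h (introT (asboolP _) nRm).
have fs n : f (s n) = n.
  case: (fP (s n)) => [[/(_ n)/irr //]|[nR h]].
  have [lt|lt|//] := ltngtP (f (s n)) n; first by case: nR; apply: slt.
  by case: (irr (s n)); apply: h.
exists f => //.
have above0 x : above x -> f x = 0.
  by move=> ax; case: (fP x) => [[]//|[/(_ (ax _))]].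
have above_up x y : above x -> R x y -> above y by move=> ax Rxy n; apply: tr (ax n) Rxy.
have fle x y : R x y -> above y \/ f x <= f y.
  move=> Rxy; case: (fP y) => [[]|[nRy _]]; [by left|right].
  rewrite leqNgt; apply/negP => lt; apply: nRy; apply: tr Rxy.
  by case: (fP x) => [[_ fx0]|[_ h]]; [rewrite fx0 in lt|apply: h].
have fcyc x y z : R x y -> R y z -> f x <> f y -> f y <> f z -> f x <> f z ->
    nat_cycle (f x) (f y) (f z).
  move=> Rxy Ryz; rewrite nat_cycleE.
  case: (fle _ _ Rxy) => [ay|].
    by rewrite (above0 _ ay) (above0 z) //; apply: above_up ay Ryz.
  case: (fle _ _ Ryz) => [az|]; last lia.
  by rewrite (above0 _ az); lia.
move=> x y z [[h1 h2]|[[h1 h2]|[h1 h2]]] n1 n2 n3.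
- exact: fcyc.
- by apply: cyc_rot2; apply: fcyc; auto.
- by apply: cyc_rot; apply: fcyc; auto.
Qed.

(** A decreasing sequence is handled by reversing the cyclic order, which has
    the same intervals; this is why C' need not be C. *)
Lemma infinite_cycle_morphism (I : Type) (C : cyclic_order I) :
  infinite_set [set: I] -> exists C' : cyclic_order I, exists f : I -> nat,
  [/\ forall Y, interval C' Y -> interval C Y, cycle_morphism C' nat_cycle f
    & forall n, exists i, f i = n].
Proof.
move=> infI.
have [o _] : [set: I] !=set0.
  by apply: contrapT => nex; apply: infI; exists 0; rewrite II0 card_eq0;
     apply/eqP/seteqP; split=> // t _; apply: nex; exists t.
have irr := @cut_irr _ C o; have tr := @cut_trans _ C o.
have [s [sinc|sdec]] := monotone_sequence irr (@cut_total _ C o) infI.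
  have [f fs fcyc] := exists_block_index irr tr sinc.
  exists C, f; split=> //; last by move=> n; exists (s n).
  by move=> x y z /(cyclically_cut o); apply: fcyc.
have tr' x y z : cut C o y x -> cut C o z y -> cut C o z x by move=> h1 h2; apply: tr h2 h1.
have [f fs fcyc] := @exists_block_index I (fun x y => cut C o y x) s irr tr' sdec.
exists (rev_cyclic_order C), f; split; [exact: interval_rev| |by move=> n; exists (s n)].
move=> x y z xyz; apply: fcyc.
by have [|[]] := @cyclically_cut _ C o z y x xyz => -[h1 h2];
  [left|right; right|right; left].
Qed.

(** If two points x, z of the preimage are separated on both sides by points u, v
    outside, the images are separated likewise, unless f x = f z and f u = f v.
    In that case two fibres cross each other, and a third value of f shows that
    f cannot preserve the cyclic order. *)
Lemma interval_preimage (I J : Type) (C : cyclic_order I) (C' : cyclic_order J)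
    (f : I -> J) (Y : set J) :
  cycle_morphism C C' f -> (forall a b, exists i, f i <> a /\ f i <> b) ->
  interval C' Y -> interval C (f @^-1` Y).
Proof.
move=> fC third iY x z Yx Yz xz.
have sep u v : C x u z -> C z v x -> ~ Y (f u) -> ~ Y (f v) -> False.
  move=> xuz zvx nYu nYv.
  have ne a b : Y (f a) -> ~ Y (f b) -> f a <> f b by move=> Ya nYb e; rewrite e in Ya.
  have xuv : C x u v by apply: cyc_trans xuz _; apply: cyc_rot2.
  have zvu : C z v u by apply: cyc_trans zvx _; apply: cyc_rot2.
  have [fxz|fxz] := pselect (f x = f z); last first.
    have uzv : C' (f x) (f u) (f z) by apply: fC => //; [apply: ne|apply/not_eq_sym/ne].
    have zvx' : C' (f z) (f v) (f x).
      by apply: fC => //; [apply: ne|apply/not_eq_sym/ne|apply: not_eq_sym].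
    by case: (iY _ _ Yx Yz fxz) => [/(_ _ uzv)|/(_ _ zvx')].
  have [fuv|fuv] := pselect (f u = f v); last first.
    have h1 : C' (f x) (f u) (f v) by apply: fC => //; apply: ne.
    have h2 : C' (f x) (f v) (f u).
      by rewrite fxz; apply: fC => //; [apply: ne|apply: not_eq_sym|apply: ne].
    by apply: (cyc_asym h1); apply: cyc_rot.
  have [w [wx wu]] := third (f x) (f u).
  have nxu : f x <> f u by apply: ne.
  have wab a b : f a = f x -> f b = f u -> C w a b \/ C a w b.
    move=> ax bu.
    have wa : w <> a by move=> e; apply: wx; rewrite e.
    have ab : a <> b by move=> e; apply: nxu; rewrite -ax -bu e.
    have bw : b <> w by move=> e; apply: wu; rewrite -e.
    by have [|h] := cyc_total C wa ab bw; [left|right; apply: cyc_rot].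
  have img1 a b : f a = f x -> f b = f u -> C w a b -> C' (f w) (f x) (f u).
    by move=> ax bu h; rewrite -ax -bu; apply: fC; rewrite // ?ax ?bu.
  have img2 a b : f a = f x -> f b = f u -> C a w b -> C' (f x) (f w) (f u).
    move=> ax bu h; rewrite -ax -bu; apply: fC; rewrite // ?ax ?bu //.
    exact: not_eq_sym.
  have [wxu|wux] := pselect (C' (f w) (f x) (f u)).
    have h a b : f a = f x -> f b = f u -> C w a b.
      move=> ax bu; have [//|/(img2 _ _ ax bu) h] := wab a b ax bu.
      by case: (cyc_asym (cyc_rot wxu)); apply: cyc_rot.
    have wzx : C w z x.
      apply: (@cyc_trans_inner _ C u); last exact: cyc_rot.
      by apply: cyc_rot2; apply: h.
    have wxz : C w x z.
      apply: (@cyc_trans_inner _ C v); last exact: cyc_rot.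
      by apply: cyc_rot2; apply: h.
    by apply: (cyc_asym wzx); apply: cyc_rot.
  have h a b : f a = f x -> f b = f u -> C a w b.
    by move=> ax bu; have [/(img1 _ _ ax bu)|] := wab a b ax bu.
  have xwz : C x w z by apply: cyc_trans xuz; apply: h.
  apply: (cyc_asym xwz); apply: cyc_trans zvx; exact: h.
apply: contrapT => /not_orP[/existsNP[u /not_implyP[xuz nYu]]
                            /existsNP[v /not_implyP[zvx nYv]]].
exact: sep xuz zvx nYu nYv.
Qed.

(** * Flowers with a sequence of petals *)

Section SequenceOfPetals.
Context {T : Type} (M : matroid T) (Q : nat -> set T) (n : nat).
Hypothesis Q_disjoint : trivIset setT Q.
Hypothesis Q_cover : \bigcup_j Q j = ground M.
Hypothesis Q_order : forall Y, interval nat_cycle Y -> nontrivial Y ->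
  connectivity M (\bigcup_(j in Y) Q j) = Some n.
Local Notation U Y := (\bigcup_(j in Y) Q j).

Lemma bigcup_disjoint (Y Z : set nat) : Y `<=` ~` Z -> U Y `<=` ~` U Z.
Proof.
move=> YZ t [i Yi Qi] [j Zj Qj]; apply: (YZ i Yi).
by rewrite (Q_disjoint (i := i) (j := j)) //; exists t.
Qed.

Lemma bigcup_sub (Y Z : set nat) : Y `<=` Z -> U Y `<=` U Z.
Proof. by move=> YZ t [i /YZ Zi Qi]; exists i. Qed.

Lemma quadripartition_bigcup (p q r s : set nat) :
  (forall j, [\/ p j, q j, r j | s j]) ->
  p `<=` ~` q -> p `<=` ~` r -> p `<=` ~` s ->
  q `<=` ~` r -> q `<=` ~` s -> r `<=` ~` s ->
  quadripartition M (U p) (U q) (U r) (U s).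
Proof.
move=> cover pq pr ps qr qs rs; split; try exact: bigcup_disjoint.
rewrite -Q_cover -!bigcup_setU; congr (U _).
apply/seteqP; split=> // j _.
by case: (cover j) => h; [left; left; left|left; left; right|left; right|right].
Qed.

Definition seg a b : set nat := [set j | a <= j <= b].

Lemma interval_seg a b : interval nat_cycle (seg a b).
Proof.
move=> x z; rewrite /seg /between /= => xab zab xz.
have [lt|lt|//] := ltngtP x z; [left|right]; move=> y /=; lia.
Qed.

Lemma order_seg a b : 0 < a <= b ->
  connectivity M (U (seg a b)) = Some n /\ connectivity M (U (~` seg a b)) = Some n.
Proof.
move=> ab.
have in_a : seg a b a by rewrite /seg /=; lia.
have out0 : ~ seg a b 0 by rewrite /seg /=; lia.
split; apply: Q_order.
- exact: interval_seg.
- by split=> e; [rewrite e in in_a|rewrite e in out0; apply: out0].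
- by apply: interval_setC; apply: interval_seg.
- split=> e; first by have : (~` seg a b) 0 by []; rewrite e.
  by have : (~` seg a b) a by rewrite e.
Qed.

(** The four consecutive arcs are {x}, x+1 .. m, {m+1} and the remaining indices,
    among them 0 and all large ones. *)
Lemma skew_seg x m : 0 < x < m ->
  skew M (U (seg x.+1 m)) (U (~` seg x m.+1)) (Q x) /\
  skew M (U (seg x.+1 m)) (U (~` seg x m.+1)) (Q m.+1).
Proof.
move=> xm.
have := @quadripartition_bigcup (seg x.+1 m) [set x] (~` seg x m.+1) [set m.+1].
rewrite !bigcup_set1 => quad.
have {}quad : quadripartition M (U (seg x.+1 m)) (Q x) (U (~` seg x m.+1)) (Q m.+1).
  { apply: quad; rewrite /seg.
  - move=> j; have [->|jx] := pselect (j = x); first by apply: Or42.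
    have [->|jm] := pselect (j = m.+1); first by apply: Or44.
    have [h|h] := pselect (x.+1 <= j <= m); first by apply: Or41.
    by apply: Or43 => /=; lia.
  all: move=> j /=; lia. }
have pqE : U (seg x.+1 m) `|` Q x = U (seg x m).
  rewrite -[Q x]bigcup_set1 -bigcup_setU; congr (U _).
  rewrite /seg; apply/seteqP; split=> j /=; first by case=> /=; lia.
  by have [->|] := pselect (j = x); [right|move=> ? ?; left => /=; lia].
have qrE : Q x `|` U (~` seg x m.+1) = U (~` seg x.+1 m.+1).
  rewrite -[Q x]bigcup_set1 -bigcup_setU; congr (U _).
  rewrite /seg; apply/seteqP; split=> j /=; first by case=> /=; lia.
  by have [->|] := pselect (j = x); [left|move=> ? ?; right => /=; lia].
have pqrE : U (seg x.+1 m) `|` Q x `|` U (~` seg x m.+1) = U (~` seg m.+1 m.+1).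
  rewrite -[Q x]bigcup_set1 -!bigcup_setU; congr (U _).
  rewrite /seg; apply/seteqP; split=> j /=; first by case=> [[]|] /=; lia.
  have [->|jx h] := pselect (j = x); first by left; right.
  have [h'|h'] := pselect (x.+1 <= j <= m); first by left; left.
  by right => /=; lia.
have xE : seg x x = [set x] by rewrite /seg; apply/seteqP; split=> j /=; lia.
apply: (skew_of_modular quad).
- by rewrite pqE; apply: (order_seg _).1; lia.
- by rewrite qrE; apply: (order_seg _).2; lia.
- by rewrite -[Q x]bigcup_set1 -xE; apply: (order_seg _).1; lia.
- by rewrite pqrE; apply: (order_seg _).2; lia.
- by [].
Qed.

Definition odd_tail : set nat := [set j | 3 <= j /\ odd j].
Definition even_tail : set nat := [set j | 3 <= j /\ ~~ odd j].

(** The gap m+1 after an odd index m separates the odd indices up to m from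
    those above. *)
Lemma skew_odd_tail x : 0 < x < 3 -> skew M (Q 0) (U odd_tail) (Q x).
Proof.
move=> x12; rewrite -[Q 0]bigcup_set1; apply: skew_local.
  by apply: bigcup_disjoint => j /= -> [].
move=> z [m [m3 om] Qz]; have xm : 0 < x < m by lia.
exists (U (odd_tail `&` seg 0 m)); split.
- by exists m => //; split=> //; rewrite /seg /=; lia.
- by apply: bigcup_sub => j [].
- apply: (skew_sub (skew_seg xm).1).
    by apply: bigcup_sub => j [[j3 _]]; rewrite /seg /=; lia.
  move=> t [[j /= -> Qt]|[[j [j3 oj] Qt] nt]].
    by exists 0 => //; rewrite /seg /=; lia.
  exists j => //; have jm : m < j.
    by rewrite ltnNge; apply/negP => jm; apply: nt; exists j.
  by rewrite /seg /=; lia.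
Qed.

(** Around an even index m the separating arc m+1 is odd, hence it already belongs
    to the base.  The arc used on the other side is 3 - x, the one among 1 and 2
    that is neither in the base nor in the two sides. *)
Lemma skew_even_tail x : 0 < x < 3 ->
  skew M (Q 0) (U even_tail) (Q x `|` U odd_tail).
Proof.
move=> x12; rewrite -[Q 0]bigcup_set1; apply: skew_local.
  by apply: bigcup_disjoint => j /= -> [].
move=> z [m [m3 em] Qz].
exists (U (even_tail `&` seg 0 m)); split.
- by exists m => //; split=> //; rewrite /seg /=; lia.
- by apply: bigcup_sub => j [].
- have xm : 0 < 3 - x < m by lia.
  have -> : Q x `|` U odd_tail = Q m.+1 `|` U (x |` (odd_tail `\ m.+1)).
    rewrite -[Q x]bigcup_set1 -[Q m.+1]bigcup_set1 -!bigcup_setU; congr (U _).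
    apply/seteqP; split=> j.
      move=> [|oj]; first by right; left.
      by have [->|jm] := pselect (j = m.+1); [left|right; right].
    move=> [->|[|[]]]; [right|by left|by right].
    by rewrite /odd_tail /=; split; [lia|].
  apply: (skew_refine _ (skew_seg xm).2).
  + by apply: bigcup_disjoint => j; rewrite /seg /=; lia.
  + by apply: bigcup_sub => j [[j3 _]]; rewrite /seg /=; lia.
  + move=> t [[j /= -> Qt]|[[j [j3 ej] Qt] nt]].
      by exists 0 => //; rewrite /seg /=; lia.
    exists j => //; have jm : m < j.
      by rewrite ltnNge; apply/negP => jm; apply: nt; exists j.
    by rewrite /seg /=; lia.
  + rewrite -bigcup_setU; apply: bigcup_sub => j h.
    have [hj|hj] := pselect (seg (3 - x).+1 m j); [by left|right].
    move: h hj; rewrite /seg /= => -[->|[[j3 oj] jm]] /=; lia.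
Qed.

Lemma skew_tail x : 0 < x < 3 -> skew M (Q 0) (U [set j | 3 <= j]) (Q x).
Proof.
move=> x12.
have -> : [set j | 3 <= j] = odd_tail `|` even_tail.
  apply/seteqP; split=> j; last by case=> [] [].
  by move=> j3; case: (boolP (odd j)); [left|right].
rewrite bigcup_setU; apply: skew_contraction; first exact: skew_odd_tail.
exact: skew_even_tail.
Qed.

(** The union of the two opposite arcs Q 1 and 3, 4, ... of the partition
    Q 0, Q 1, Q 2, (3, 4, ...). *)
Lemma crossing_order : connectivity M (U [set j | j = 1 \/ 3 <= j]) = Some n.
Proof.
have := @quadripartition_bigcup [set 0] [set 1] [set j | 3 <= j] [set 2].
rewrite !bigcup_set1 => quad.
have {}quad : quadripartition M (Q 0) (Q 1) (U [set j | 3 <= j]) (Q 2).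
  { apply: quad => //.
  - move=> [|[|[|j]]]; [exact: Or41|exact: Or42|exact: Or44|exact: Or43].
  all: by move=> j /=; lia. }
have pqE : Q 0 `|` Q 1 = U (seg 0 1).
  rewrite -[Q 0]bigcup_set1 -[Q 1]bigcup_set1 -bigcup_setU; congr (U _).
  by apply/seteqP; split=> j; rewrite /seg /=; lia.
have qE : Q 1 = U (seg 1 1).
  rewrite -[Q 1]bigcup_set1; congr (U _).
  by apply/seteqP; split=> j; rewrite /seg /=; lia.
have pqrE : Q 0 `|` Q 1 `|` U [set j | 3 <= j] = U (~` seg 2 2).
  rewrite -[Q 0]bigcup_set1 -[Q 1]bigcup_set1 -!bigcup_setU; congr (U _).
  by apply/seteqP; split=> j; rewrite /seg /=; lia.
have o1 : connectivity M (Q 0 `|` Q 1) = Some n.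
  rewrite pqE; apply: Q_order; first exact: interval_seg.
  split=> e; first by have : seg 0 1 0 by []; rewrite e.
  by have : seg 0 1 2 by rewrite e.
have o2 : connectivity M (Q 1) = Some n by rewrite qE; exact: (order_seg _).1.
have o3 : connectivity M (Q 0 `|` Q 1 `|` U [set j | 3 <= j]) = Some n.
  by rewrite pqrE; exact: (order_seg _).2.
have [b cb /addnI bn] := modular_of_skew quad o1 o2 o3
  (skew_tail (x := 1) isT) (skew_tail (x := 2) isT).
rewrite -bn -cb; congr (connectivity _ _).
by rewrite -[Q 1]bigcup_set1 -bigcup_setU.
Qed.

End SequenceOfPetals.

(** * Merging petals, and the theorem *)

Lemma bigcup_fibers (T I J : Type) (P : I -> set T) (f : I -> J) (Y : set J) :
  \bigcup_(j in Y) \bigcup_(i in f @^-1` [set j]) P i = \bigcup_(i in f @^-1` Y) P i.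
Proof.
apply/seteqP; split=> t; first by move=> [j Yj [i /= fi Pi]]; exists i; rewrite //= fi.
by move=> [i /= Yi Pi]; exists (f i) => //; exists i.
Qed.

Lemma trivIset_fibers (T I J : Type) (P : I -> set T) (f : I -> J) :
  trivIset setT P -> trivIset setT (fun j => \bigcup_(i in f @^-1` [set j]) P i).
Proof.
move=> dP j1 j2 _ _ [t [[i1 /= <- P1] [i2 /= <- P2]]].
by rewrite (dP i1 i2) //; exists t.
Qed.

Lemma concatenation_fibers (T : Type) (E : set T) lam k (I J : Type)
    (C : cyclic_order I) (C' : cyclic_order J) (P : I -> set T) (f : I -> J) :
  pseudoflower E lam k C P -> (forall j, exists i, f i = j) ->
  (forall Y, interval C' Y -> interval C (f @^-1` Y)) ->
  concatenation E lam k C P C' (fun j => \bigcup_(i in f @^-1` [set j]) P i).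
Proof.
move=> [P0 Pd Pc Po] surj pre; split; last first.
  by exists f; split=> // i t Pit; exists i.
split.
- by move=> j; have [i fi] := surj j; have [t Pit] := P0 i; exists t, i.
- exact: trivIset_fibers.
- by rewrite bigcup_fibers preimage_setT.
- by move=> Y iY; rewrite bigcup_fibers; apply/Po/pre.
Qed.

Definition four_cycle : cyclic_order 'I_4.
Proof.
exists (fun x y z : 'I_4 => nat_cycle x y z).
- by move=> x y z; apply: cyc_rot.
- by move=> x y z; apply: cyc_asym.
- by move=> x y z w; apply: cyc_trans.
- move=> x y z xy yz zx.
  by apply: cyc_total => /val_inj.
Defined.

Theorem lemma11p8 (T : Type) (M : matroid T) (k : nat) (I : Type)
    (C : cyclic_order I) (P : I -> set T) :
  infinite_set [set: I] -> ~ daisy (ground M) (connectivity M) k C P.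
Proof.
move=> infI [[pfP _ exact_order] crossing].
have [C' [f [CC' fC surj]]] := infinite_cycle_morphism C infI.
have nat_pre Y : interval nat_cycle Y -> interval C (f @^-1` Y).
  move=> iY; apply/CC'/(interval_preimage fC) => // a b.
  by have [i fi] := surj (a + b).+1; exists i; rewrite fi; lia.
(* The four petals of the forbidden concatenation: indices 0, 1, 2 and >= 3. *)
pose g i : 'I_4 := inord (minn (f i) 3).
have gE i : g i = minn (f i) 3 :> nat by rewrite inordK // ltnS geq_minr.
clearbody g.
have four_pre Y : interval four_cycle Y -> interval C (g @^-1` Y).
  move=> iY; apply/CC'/(@interval_preimage _ _ C' four_cycle) => //.
    move=> x y z xyz gxy gyz gxz.
    have ne u v : g u <> g v -> minn (f u) 3 <> minn (f v) 3.
      by move=> guv; rewrite -!gE => /val_inj.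
    have := fC x y z xyz; rewrite /= !gE.
    move: (ne _ _ gxy) (ne _ _ gyz) (ne _ _ gxz); lia.
  move=> a b; have [c [c3 ca cb]] : exists c, [/\ c < 3, c <> a & c <> b].
    have [[]|h] := pselect (0 <> a /\ 0 <> b); first by exists 0.
    have [[]|h'] := pselect (1 <> a /\ 1 <> b); first by exists 1.
    by exists 2; split; lia.
  have [i fi] := surj c; exists i; have := gE i; rewrite fi => gi.
  by split=> e; [apply: ca|apply: cb]; rewrite -e gi; lia.
have surj4 j : exists i, g i = j.
  have [i fi] := surj j; exists i; apply: val_inj; rewrite /= gE fi.
  by have := ltn_ord j; lia.
pose Q j := \bigcup_(i in f @^-1` [set j]) P i.
have nontriv Y : nontrivial Y -> nontrivial (f @^-1` Y).
  move=> [Y0 YT]; split=> e.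
    apply: Y0; apply/seteqP; split=> // j Yj; have [i fi] := surj j.
    by have : (f @^-1` Y) i; [rewrite /= fi|rewrite e].
  apply: YT; apply/seteqP; split=> // j _; have [i <-] := surj j.
  by have : (f @^-1` Y) i by rewrite e.
have [n kn] : exists n, k = n.+1.
  have [||n _ <-] := exact_order (f @^-1` [set 0]); last by exists n.
    by apply: nat_pre => x z -> ->.
  apply: nontriv; split=> e; first by have : [set 0] 0 by []; rewrite e.
  by have : [set 0] 1 by rewrite e.
have Q_order Y : interval nat_cycle Y -> nontrivial Y ->
    connectivity M (\bigcup_(j in Y) Q j) = Some n.
  move=> iY nY; rewrite bigcup_fibers.
  have [|m -> mk] := exact_order _ (nat_pre Y iY); first exact: nontriv.
  by congr Some; move: mk; rewrite kn => -[].
have Qd : trivIset setT Q by apply: trivIset_fibers; case: pfP.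
have Qc : \bigcup_j Q j = ground M.
  by rewrite bigcup_fibers preimage_setT; case: pfP.
have cross := crossing_order Qd Qc Q_order.
pose Y : set 'I_4 := [set j | j = 1 :> nat \/ j = 3 :> nat].
have Y1 : Y (inord 1) by left; rewrite inordK.
have Y3 : Y (inord 3) by right; rewrite inordK.
have nY : nontrivial Y.
  split=> e; first by rewrite e in Y1.
  have : Y ord0 by rewrite e.
  by case.
have fin4 : finite_set [set: 'I_4] by exact: finite_finset.
have conc := concatenation_fibers pfP surj4 four_pre.
have [/(_ _) iY _] := crossing _ _ _ fin4 conc Y nY.
have {}iY : interval four_cycle Y.
  apply: iY; exists n => //; rewrite bigcup_fibers -cross bigcup_fibers.
  congr (connectivity M (bigcup _ _)); apply/seteqP; split=> i; rewrite /Y /= gE; lia.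
have ne13 : inord 1 <> inord 3 :> 'I_4 by move=> /(congr1 val); rewrite /= !inordK.
case: (iY _ _ Y1 Y3 ne13) => [/(_ (inord 2))|/(_ ord0)].
  by rewrite /between /Y /= !inordK // => -[].
by rewrite /between /Y /= !inordK // => -[].
Qed.
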